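(* Suppose $\mathbb{H}$ is a complex Hilbert space and $T\in \mathbb{L}(\mathbb{H})$, $T\neq 0$. Let $\mathcal{W}$ be a subspace of $\mathbb{L}(\mathbb{H})$. Suppose there exist $n\in\mathbb{N}$, unit vectors $x_1,x_2,\ldots,x_n\in \mathbb{H}$ and real numbers $\lambda_1,\lambda_2,\ldots,\lambda_n>0$ such that $|\langle Tx_i,x_i\rangle|=w(T)$ for all $1\leq i\leq n$, $\sum_{i=1}^n\lambda_i=1$ and \[\sum_{i=1}^n\lambda_i\overline{\langle Tx_i,x_i\rangle}\langle Ax_i,x_i\rangle=0 \quad\text{for all }A\in \mathcal{W}.\] Then $T\perp_w \mathcal{W}$.
   Context: $\mathbb{L}(\mathbb{H})$ is the space of all bounded linear operators on $\mathbb{H}$. The numerical radius of $S\in\mathbb{L}(\mathbb{H})$ is $w(S)=\sup\{|\langle Sx,x\rangle|: x\in\mathbb{H},\ \|x\|=1\}$; on a complex Hilbert space $w(\cdot)$ is a norm on $\mathbb{L}(\mathbb{H})$. Numerical radius orthogonality $\perp_w$ is Birkhoff-James orthogonality with respect to this norm: $T\perp_w A$ means $w(T+\lambda A)\geq w(T)$ for all $\lambda\in\mathbb{C}$, and $T\perp_w\mathcal{W}$ means $T\perp_w A$ for all $A\in\mathcal{W}$. *)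

(* Defs.v *)
From HB Require Import structures.
From mathcomp Require Import all_boot all_order all_algebra.
From mathcomp Require Import sesquilinear complex.
From mathcomp Require Import boolp classical_sets functions reals.
From mathcomp Require Import topology normedtype.

Set Implicit Arguments.
Unset Strict Implicit.
Unset Printing Implicit Defensive.

Import Order.TTheory GRing.Theory Num.Theory.
Import numFieldNormedType.Exports.
Import ComplexField.Normc.

Local Open Scope classical_set_scope.
Local Open Scope ring_scope.
Local Open Scope complex_scope.

(* The inner product is linear in its first argument and conjugate-linear in
   the second one; its norm is that of the underlying complete normed space. *)
Record hilbertType (R : realType) := HilbertType {
  hilbert_sort :> completeNormedModType R[i] ;
  inner : {dot hilbert_sort for (@Num.conj R[i])} ;
  inner_norm : forall x : hilbert_sort, inner x x = `|x| ^+ 2 }.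

Notation "''[' u , v ]" := (inner _ u v) : ring_scope.

Section BoundedOperators.
Variables (R : realType) (H : hilbertType R).

Definition bounded_linear : {pred H -> H} := fun f =>
  `[< linear f /\ exists M : R[i], forall x, `|f x| <= M * `|x| >].

Lemma bounded_linear_submod_closed : submod_closed bounded_linear.
Proof.
split.
  apply/asboolP; split=> [a x y|]; first by rewrite /= scaler0 addr0.
  by exists 0 => x; rewrite normr0 mul0r.
move=> a f g /asboolP[lf [M fM]] /asboolP[lg [N gN]]; apply/asboolP; split.
  move=> b x y; rewrite -[LHS]/(a *: f _ + g _) lf lg.
  rewrite -[(a *: f + g) x]/(a *: f x + g x) -[(a *: f + g) y]/(a *: f y + g y).
  by rewrite !scalerDr !scalerA (mulrC b a) addrACA.
exists (`|a| * M + N) => x; rewrite -[(a *: f + g) x]/(a *: f x + g x).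
rewrite (le_trans (ler_normD _ _))// mulrDl lerD ?gN// normrZ -mulrA.
by rewrite ler_wpM2l ?fM.
Qed.

HB.instance Definition _ := GRing.isSubmodClosed.Build
  R[i] (H -> H) bounded_linear bounded_linear_submod_closed.

Record boundedOp := BoundedOp {
  boundedOp_fun :> H -> H ;
  _ : boundedOp_fun \in bounded_linear }.

HB.instance Definition _ := [isSub for boundedOp_fun].
HB.instance Definition _ := [Choice of boundedOp by <:].
HB.instance Definition _ := [SubChoice_isSubLmodule of boundedOp by <:].

End BoundedOperators.

Notation "''L' ( H )" := (boundedOp H) (at level 0, format "''L' ( H )") : type_scope.

Section NumericalRadius.
Variables (R : realType) (H : hilbertType R).

Definition numerical_radius (S : 'L(H)) : R :=
  sup [set normc '[S x, x] | x in [set x : H | `|x| = 1]].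

Definition radius_orthogonal (T A : 'L(H)) : Prop :=
  forall l : R[i], numerical_radius (T + l *: A) >= numerical_radius T.

Definition radius_orthogonal_to (T : 'L(H)) (W : {pred 'L(H)}) : Prop :=
  forall A, A \in W -> radius_orthogonal T A.

End NumericalRadius.

(* Main.v *)
(** Write [S = T + l A].  Weighting by [lambda i * conj <T x_i, x_i>] kills the
    [A]-part, so [w(T)^2 = sum_i lambda_i conj(<T x_i, x_i>) <S x_i, x_i>], which
    is at most [w(T) * w(S)] in modulus.  When [w(T) = 0] it suffices that
    [w(S) >= 0]. *)
Require Import Defs.
From mathcomp Require Import all_boot all_order all_algebra.
From mathcomp Require Import complex reals normedtype.
From mathcomp Require Import sesquilinear boolp.
Import Order.TTheory GRing.Theory Num.Theory.
Import ComplexField.Normc.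
Local Open Scope ring_scope.
Local Open Scope complex_scope.

Lemma normC_normc (R : realType) (z : R[i]) : `|z| = (normc z)%:C.
Proof. by []. Qed.

(* Pythagoras for the decomposition of [u] along [x]. *)
Lemma norm_inner_unit_le {R : realType} {H : hilbertType R} (u x : H) :
  `|x| = 1 -> `|'[u, x]| <= `|u|.
Proof.
move=> x1; set c := '[u, x].
have xx : '[x, x] = 1 by rewrite inner_norm x1 expr1n.
have ortho : '[u - c *: x, c *: x] = 0.
  by rewrite linearZr_LR linearBl linearZl_LR/= xx mulr1 subrr mulr0.
rewrite -(@ler_pXn2r _ 2) ?nnegrE// -!inner_norm.
rewrite -[X in _ <= '[X, X]](subrK (c *: x)) hnormDd//.
(* As [x] is a unit vector, the component along [x] contributes exactly the square of [|c|]; the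
   orthogonal remainder contributes a nonnegative term. *)
rewrite [X in _ + X]inner_norm normrZ x1 mulr1 lerDr.
exact: dnorm_ge0.
Qed.

(** Boundedness of [S] and Cauchy-Schwarz bound the set of values, so [sup] is a true supremum and
    not a default value. *)
Lemma normc_le_numerical_radius (R : realType) (H : hilbertType R) (S : 'L(H))
    (x : H) : `|x| = 1 -> normc '[S x, x] <= numerical_radius S.
Proof.
move=> x1; apply: ub_le_sup; last by exists x.
(* The operator bound [M] is a complex number; the order of [R[i]] compares real parts, so its real
   part is a real bound. *)
case: S => S /= /asboolP[_ [M SM]]; exists (complex.Re M) => _ [y y1 <-].
have := le_trans (norm_inner_unit_le (S y) y y1) (SM y).
by rewrite y1 mulr1 normC_normc lecE /= => /andP[].
Qed.

Theorem theorem2p11 (R : realType) (H : hilbertType R)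
    (T : 'L(H)) (T_neq0 : T != 0)
    (W : {pred 'L(H)}) (W_subspace : submod_closed W)
    (HW : exists (n : nat) (x : 'I_n -> H) (lambda : 'I_n -> R),
        (forall i, `|x i| = 1)
        /\ (forall i, 0 < lambda i)
        /\ (forall i, normc '[T (x i), x i] = numerical_radius T)
        /\ \sum_(i < n) lambda i = 1
        /\ (forall A : 'L(H), A \in W ->
             \sum_(i < n) (lambda i)%:C * Num.conj '[T (x i), x i]
                            * '[A (x i), x i] = 0)) :
  radius_orthogonal_to T W.
Proof.
case: HW => n [x [lambda [x1 [lam0 [Tx [lam1 orth]]]]]] A AW l.
set w := numerical_radius T; set S := T + l *: A; set v := numerical_radius S.
have Sx i : '[S (x i), x i] = '[T (x i), x i] + l * '[A (x i), x i].
  by rewrite linearDl linearZl_LR.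
have Sv i : `|'[S (x i), x i]| <= v%:C.
  by rewrite normC_normc lecR normc_le_numerical_radius.
have Tw i : `|'[T (x i), x i]| = w%:C by rewrite normC_normc Tx.
(* An empty family of weights would sum to 0, not 1. The index [i0] gives the signs of [w] and [v],
   each bounding a modulus. *)
have [i0 _] : exists i : 'I_n, xpredT i.
  apply/existsP; apply: contra_eqT lam1; rewrite negb_exists => /forallP noi.
  by rewrite big1 1?eq_sym ?oner_neq0// => i; have := noi i.
have w0 : 0 <= w by rewrite -lecR rmorph0 -(Tw i0).
have v0 : 0 <= v by rewrite -lecR rmorph0 (le_trans _ (Sv i0)).
have w2E : (w ^+ 2)%:C =
    \sum_(i < n) (lambda i)%:C * Num.conj '[T (x i), x i] * '[S (x i), x i].
  under eq_bigr do rewrite Sx mulrDr (mulrCA _ l).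
  rewrite big_split/= -mulr_sumr (orth A)// mulr0 addr0.
  (* Each remaining term is [lambda i] times a squared modulus, the same [w ^+ 2] for all [i]. *)
  under eq_bigr => i _ do
    rewrite -mulrA (mulrC (Num.conj _)) -normCK Tw -rmorphXn -rmorphM.
  by rewrite -rmorph_sum -mulr_suml lam1 mul1r.
have w2_le : w ^+ 2 <= w * v.
  have w2_ge0 : 0 <= (w ^+ 2)%:C by rewrite rmorphXn exprn_ge0// lecR.
  (* The comparison moves to [R[i]], where [w ^+ 2] is its own modulus, so the triangle inequality
     applies to the sum in [w2E]. *)
  rewrite -lecR -(ger0_norm w2_ge0) w2E.
  have -> : (w * v)%:C = \sum_(i < n) (lambda i)%:C * w%:C * v%:C.
    by rewrite -!mulr_suml -rmorph_sum lam1 mul1r rmorphM.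
  apply: le_trans (ler_norm_sum _ _ _) (ler_sum _ _) => i _.
  rewrite !normrM norm_conjC Tw (ger0_norm (_ : 0 <= (lambda i)%:C)).
    by rewrite ler_wpM2l ?Sv// mulr_ge0 ?lecR// ltW.
  by rewrite lecR ltW.
have [->//|wn0] := eqVneq w 0.
by rewrite -(@ler_pM2l _ w) ?lt_def ?wn0// -expr2.
Qed.
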